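(* Let $(G,b)$, $G=(V,\vec E)$, be a connected, locally finite directed weighted graph with measure $m:V\to(0,\infty)$ such that every vertex $x$ has some $y$ with $(x,y)\in\vec E$. If Assumptions $(\beta)$ and $(\gamma)$ are satisfied, then the Laplacian $\Delta$ (with domain $\mathcal{C}_c(V)$ in the Hilbert space $\ell^2(V,m)$) is sectorial.
   Context: A directed weighted graph $(G,b)$, $G=(V,\vec E)$, consists of a countable vertex set $V$, a set $\vec E\subset V\times V$ of directed edges and a weight $b:V\times V\to[0,\infty)$ with $b(x,x)=0$ for all $x$ and $b(x,y)>0$ iff $(x,y)\in\vec E$ (no symmetry of $b$ is assumed). $m:V\to(0,\infty)$ is a measure on $V$. Locally finite: for each $x$ only finitely many $y$ satisfy $(x,y)\in\vec E$ or $(y,x)\in\vec E$. Connected: any two vertices are related by a path, i.e. by a finite sequence of directed edges $(x_1,y_1),\dots,(x_n,y_n)$ with $x_i=y_{i-1}$ going from one of the two vertices to the other. $\mathcal{C}_c(V)$ is the space of finitely supported functions $V\to\mathbb{C}$; $\ell^2(V,m)$ is the Hilbert space with scalar product $(f,g)_m=\sum_{x\in V}m(x)f(x)\overline{g(x)}$. The Laplacian is $\Delta f(x)=\frac1{m(x)}\sum_{y\in V}b(x,y)(f(x)-f(y))$ for $f\in\mathcal{C}_c(V)$. Assumption $(\beta)$: for all $x\in V$, $\sum_{y\in V}b(x,y)=\sum_{y\in V}b(y,x)$. Assumption $(\gamma)$: there is a constant $M>0$ such that for all $x\in V$, $\sum_{y\in V}|b(x,y)-b(y,x)|\le M\,m(x)$.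 The numerical range of an operator $A$ with domain $D(A)$ is $W(A)=\{(Af,f): f\in D(A),\ \|f\|=1\}$. $A$ is sectorial if $W(A)$ is contained in a sector $S_{a,\theta}=\{z\in\mathbb{C}: |\arg(z-a)|\le\theta\}$ for some $a\in\mathbb{R}$ and $\theta\in[0,\frac{\pi}{2})$. *)

(* Defs.v *)
From HB Require Import structures.
From mathcomp Require Import all_boot all_order all_algebra.
From mathcomp Require Import complex.
From mathcomp Require Import all_classical all_reals all_analysis.
From mathcomp Require Import ring lra.

Set Implicit Arguments.
Unset Strict Implicit.
Unset Printing Implicit Defensive.

Import Order.TTheory GRing.Theory Num.Theory.
Import ComplexField.Normc.

Local Open Scope classical_set_scope.
Local Open Scope ring_scope.
Local Open Scope complex_scope.

Record wdigraph (R : realType) (V : countType) := WDigraph {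
  edge : rel V;
  weight : V -> V -> R;
  weight_ge0 : forall x y, 0 <= weight x y;
  weight_diag : forall x, weight x x = 0;
  weight_gt0 : forall x y, (0 < weight x y) = edge x y }.

Definition locally_finite (R : realType) (V : countType) (G : wdigraph R V) :=
  forall x, finite_set [set y | edge G x y \/ edge G y x].

Definition dipath (R : realType) (V : countType) (G : wdigraph R V) (x y : V) :=
  exists2 p : seq V, path (edge G) x p & last x p = y.

(* One direction suffices; the empty path is only used to relate x to itself. *)
Definition digraph_connected (R : realType) (V : countType)
    (G : wdigraph R V) :=
  forall x y, dipath G x y \/ dipath G y x.

Definition assumption_beta (R : realType) (V : countType) (G : wdigraph R V) :=
  forall x, (\esum_(y in [set: V]) (weight G x y)%:E =
             \esum_(y in [set: V]) (weight G y x)%:E)%E.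

Definition assumption_gamma (R : realType) (V : countType) (G : wdigraph R V)
    (m : V -> R) :=
  exists2 M : R, 0 < M &
    forall x, (\esum_(y in [set: V]) `|weight G x y - weight G y x|%:E
               <= (M * m x)%:E)%E.

(* Sum of an absolutely summable family; the value is meaningless otherwise. *)
Definition rsum (R : realType) (V : choiceType) (u : V -> R) : R :=
  fine (\esum_(x in [set: V]) (Num.max (u x) 0)%:E) -
  fine (\esum_(x in [set: V]) (Num.max (- u x) 0)%:E).

Definition csum (R : realType) (V : choiceType) (u : V -> R[i]) : R[i] :=
  rsum (fun x => complex.Re (u x)) +i* rsum (fun x => complex.Im (u x)).

Definition l2 (R : realType) (V : choiceType) (m : V -> R) :
    set (V -> R[i]) :=
  [set f | summable [set: V] (fun x => (m x * normc (f x) ^+ 2)%:E)].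

Definition l2dot (R : realType) (V : choiceType) (m : V -> R)
    (f g : V -> R[i]) : R[i] :=
  csum (fun x => (m x)%:C * f x * conjc (g x)).

Definition l2norm (R : realType) (V : choiceType) (m : V -> R)
    (f : V -> R[i]) : R :=
  Num.sqrt (complex.Re (l2dot m f f)).

(* [op] is constrained on [dom] only; its values elsewhere are irrelevant. *)
Record l2_operator (R : realType) (V : choiceType) (m : V -> R) := L2Operator {
  dom : set (V -> R[i]);
  op : (V -> R[i]) -> V -> R[i];
  dom_l2 : dom `<=` l2 m;
  dom0 : dom (fun=> 0);
  dom_lin : forall (a : R[i]) f g,
    dom f -> dom g -> dom (fun x => a * f x + g x);
  op_l2 : forall f, dom f -> l2 m (op f);
  op_lin : forall (a : R[i]) f g, dom f -> dom g ->
    op (fun x => a * f x + g x) = (fun x => a * op f x + op g x) }.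

Definition numerical_range (R : realType) (V : choiceType) (m : V -> R)
    (A : l2_operator m) : set R[i] :=
  [set z | exists2 f, dom A f & l2norm m f = 1 /\ z = l2dot m (op A f) f].

(* Principal argument in ]-pi, pi]. The convention arg 0 = 0 puts the vertex
   of a sector into the sector. *)
Definition arg (R : realType) (z : R[i]) : R :=
  if z == 0 then 0
  else let t := acos (complex.Re z / normc z) in
       if 0 <= complex.Im z then t else - t.

Definition sector (R : realType) (a theta : R) : set R[i] :=
  [set z | `|arg (z - a%:C)| <= theta].

Definition sectorial (R : realType) (V : choiceType) (m : V -> R)
    (A : l2_operator m) :=
  exists a theta : R,
    0 <= theta < pi / 2 /\ numerical_range A `<=` sector a theta.

Definition Cc (R : realType) (V : choiceType) : set (V -> R[i]) :=
  [set f | finite_set [set x | f x != 0]].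

(* Under local finiteness, [x] has finitely many out-neighbours, so this is a
   genuine finite sum. *)
Definition laplacian (R : realType) (V : countType) (G : wdigraph R V)
    (m : V -> R) (f : V -> R[i]) : V -> R[i] :=
  fun x => ((m x)^-1)%:C *
    \sum_(y \in [set: V]) (weight G x y)%:C * (f x - f y).

Lemma arg_polar (R : realType) (z : R[i]) :
  z = (normc z * cos (arg z)) +i* (normc z * sin (arg z)).
Proof.
rewrite /arg; have [->|z0] := eqVneq z 0.
  by rewrite normc0 !mul0r.
have nz0 : normc z != 0 by apply: contra z0 => /eqP/eq0_normc ->.
have [x [y zE]] : exists x y, z = x +i* y by case: z {z0 nz0} => x y; exists x, y.
have n0 : 0 < normc z by rewrite lt_def nz0; rewrite zE /= sqrtr_ge0.
have n2 : normc z ^+ 2 = x ^+ 2 + y ^+ 2.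
  by rewrite zE /= sqr_sqrtr// addr_ge0// sqr_ge0.
have b : (x / normc z) ^+ 2 <= 1.
  by rewrite expr_div_n n2 ler_pdivrMr ?mul1r -n2 ?exprn_gt0// n2 lerDl sqr_ge0.
have b1 : -1 <= x / normc z <= 1.
  by rewrite -ler_norml -(@ler_pXn2r _ 2)// ?nnegrE// expr1n real_normK ?num_real.
have sE : normc z * sin (acos (x / normc z)) = `|y|.
  rewrite sin_acos// -[X in X * _]gtr0_norm// -sqrtr_sqr -sqrtrM ?sqr_ge0//.
  rewrite mulrBr mulr1 expr_div_n mulrCA divff ?mulr1 ?sqrf_eq0//.
  by rewrite n2 addrAC subrr add0r sqrtr_sqr.
have cE : normc z * cos (acos (x / normc z)) = x.
  by rewrite acosK ?in_itv// mulrCA divff ?mulr1.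
rewrite [LHS]zE [complex.Re z](_ : _ = x) ?zE// -zE.
rewrite [complex.Im z](_ : _ = y) ?zE// -zE; case: leP => y0.
  by rewrite cE sE ger0_norm.
by rewrite cosN sinN mulrN cE sE ltr0_norm// opprK.
Qed.

Lemma esum_finite_supp (R : realType) (V : choiceType) (u : V -> R) :
  (forall x, 0 <= u x) -> finite_set [set x | u x != 0] ->
  (\esum_(x in [set: V]) (u x)%:E = (\sum_(x \in [set: V]) u x)%:E)%E.
Proof.
move=> u0 fu.
rewrite -(fsbig_widen [set x | u x != 0] setT)//; last first.
  by move=> x [_ /= /negP]; rewrite negbK => /eqP.
rewrite -fsumEFin// -esum_fset//; last by move=> x _; rewrite lee_fin.
rewrite [RHS]esum_mkcond; apply: eq_esum => x _.
by case: ifPn => //; rewrite notin_setE /= => /negP; rewrite negbK => /eqP ->.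
Qed.

Lemma rsum_finite_supp (R : realType) (V : choiceType) (u : V -> R) :
  finite_set [set x | u x != 0] -> rsum u = \sum_(x \in [set: V]) u x.
Proof.
move=> fu; rewrite /rsum.
have fp : finite_set [set x | Num.max (u x) 0 != 0].
  apply: sub_finite_set fu => x /=; apply: contra => /eqP ->.
  by rewrite maxxx.
have fn : finite_set [set x | Num.max (- u x) 0 != 0].
  apply: sub_finite_set fu => x /=; apply: contra => /eqP ->.
  by rewrite oppr0 maxxx.
rewrite !esum_finite_supp//; try by move=> x; rewrite le_max lexx orbT.
have w (v : V -> R) : (forall x, u x = 0 -> v x = 0) ->
    \sum_(x \in [set: V]) v x = \sum_(x \in [set x | u x != 0]) v x.
  move=> uv; apply/esym/fsbig_widen => // x [_ /= /negP].
  by rewrite negbK => /eqP /uv.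
rewrite /= (w u)// !w; try by move=> x ->; rewrite ?oppr0 maxxx.
rewrite !fsbig_finite//= -sumrB; apply: eq_bigr => x _.
have [ux|/ltW ux] := leP (u x) 0.
  by rewrite max_l ?oppr_ge0// sub0r opprK.
by rewrite max_r ?subr0// oppr_le0.
Qed.

Lemma Cc_l2 (R : realType) (V : choiceType) (m : V -> R) : @Cc R V `<=` l2 m.
Proof.
move=> f /= fC; rewrite /l2 /= /summable.
under eq_esum do rewrite abse_EFin.
rewrite esum_finite_supp ?ltry//.
apply: sub_finite_set fC => x /=; apply: contra => /eqP ->.
by rewrite normc0 expr0n mulr0 normr0.
Qed.

Lemma Cc0 (R : realType) (V : choiceType) : @Cc R V (fun=> 0).
Proof.
rewrite /Cc /= (_ : [set _ | _] = set0)//.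
by apply/seteqP; split => x //=; rewrite eqxx.
Qed.

Lemma Cc_lin (R : realType) (V : choiceType) (a : R[i]) (f g : V -> R[i]) :
  Cc f -> Cc g -> Cc (fun x => a * f x + g x).
Proof.
move=> /= fC gC.
apply: (@sub_finite_set _ _ ([set x | f x != 0] `|` [set x | g x != 0])).
  2: by rewrite finite_setU.
move=> x /=; have [->|] := eqVneq (f x) 0; last by left.
by rewrite mulr0 add0r; right.
Qed.

Lemma weight_eq0 (R : realType) (V : countType) (G : wdigraph R V) (x y : V) :
  ~ (edge G x y \/ edge G y x) -> weight G x y = 0.
Proof.
move=> xy; apply/eqP; rewrite eq_le weight_ge0 andbT leNgt weight_gt0.
by apply/negP => e; apply: xy; left.
Qed.

Lemma laplacianE (R : realType) (V : countType) (G : wdigraph R V) (m : V -> R)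
    (f : V -> R[i]) (x : V) :
  laplacian G m f x = ((m x)^-1)%:C *
  \sum_(y \in [set y | edge G x y \/ edge G y x])
    (weight G x y)%:C * (f x - f y).
Proof.
congr (_ * _); apply/esym/fsbig_widen => // y [_ /weight_eq0 /= ->].
by rewrite mul0r.
Qed.

Lemma laplacian_Cc (R : realType) (V : countType) (G : wdigraph R V)
    (m : V -> R) (lf : locally_finite G) (f : V -> R[i]) :
  Cc f -> Cc (laplacian G m f).
Proof.
move=> fC; apply: (@sub_finite_set _ _ ([set x | f x != 0] `|`
  \bigcup_(y in [set y | f y != 0]) [set x | edge G y x \/ edge G x y])).
  move=> x /= Lx; apply: contrapT => /not_orP[/negP].
  rewrite negbK => /eqP fx nx; move: Lx; rewrite laplacianE fsbig1 ?mulr0 ?eqxx//.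
  move=> y /= xy; rewrite fx sub0r; have [->|fy] := eqVneq (f y) 0.
    by rewrite oppr0 mulr0.
  by case: nx; exists y => //=; case: xy; [right|left].
by rewrite finite_setU; split => //; apply: bigcup_finite => // y _; exact: lf.
Qed.

Lemma laplacian_lin (R : realType) (V : countType) (G : wdigraph R V)
    (m : V -> R) (lf : locally_finite G) (a : R[i]) (f g : V -> R[i]) :
  laplacian G m (fun x => a * f x + g x) =
  (fun x => a * laplacian G m f x + laplacian G m g x).
Proof.
apply/funext => x; rewrite !laplacianE !fsbig_finite; try exact: lf.
rewrite mulrCA -mulrDr; congr (_ * _); rewrite mulr_sumr -big_split.
by apply: eq_bigr => y _ /=; ring.
Qed.

Definition laplacian_op (R : realType) (V : countType) (G : wdigraph R V)
    (m : V -> R) (lf : locally_finite G) : l2_operator m :=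
  L2Operator (dom := @Cc R V) (op := laplacian G m)
    (@Cc_l2 R V m) (@Cc0 R V) (@Cc_lin R V)
    (fun f fC => @Cc_l2 R V m _ (laplacian_Cc m lf fC))
    (fun a f g _ _ => laplacian_lin m lf a f g).

(* Main.v *)
Require Import Defs.
From mathcomp Require Import all_boot all_order all_algebra.
From mathcomp Require Import complex.
From mathcomp Require Import all_classical all_reals all_analysis.
From mathcomp Require Import ring lra.

(** The numerical range lies in a half-strip.  Reindexing a double sum,
    assumption (beta) gives [Re (Df, f) = 1/2 sum b(x,y) |f x - f y|^2 >= 0].
    The form [Im (f y * conj (f x))] is antisymmetric in [(x, y)], so in
    [Im (Df, f)] only [b(x,y) - b(y,x)] matters, and [2 |f x| |f y| <=
    |f x|^2 + |f y|^2] together with (gamma) gives [|Im (Df, f)| <= M/2 |f|^2].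
    The half-strip [Re z >= 0, |Im z| <= M/2] is contained in the sector with
    vertex [-M/2] and half-angle [pi/4]. *)

Set Implicit Arguments.
Unset Strict Implicit.
Unset Printing Implicit Defensive.

Import Order.TTheory GRing.Theory Num.Theory.
Import ComplexField.Normc.

Local Open Scope classical_set_scope.
Local Open Scope ring_scope.
Local Open Scope complex_scope.

Lemma Re_sum (R : realType) (I : Type) (s : seq I) (F : I -> R[i]) :
  complex.Re (\sum_(i <- s) F i) = \sum_(i <- s) complex.Re (F i).
Proof. by apply: big_morph => // -[? ?] [? ?]. Qed.

Lemma Im_sum (R : realType) (I : Type) (s : seq I) (F : I -> R[i]) :
  complex.Im (\sum_(i <- s) F i) = \sum_(i <- s) complex.Im (F i).
Proof. by apply: big_morph => // -[? ?] [? ?]. Qed.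

Lemma fsum_seq (A : nmodType) (V : choiceType) (u : V -> A) (s : seq V) :
  uniq s -> (forall x, x \notin s -> u x = 0) ->
  \sum_(x \in [set: V]) u x = \sum_(x <- s) u x.
Proof.
move=> us u0; rewrite -(fsbig_widen [set` s] setT)//; last first.
  by move=> x [_ /= /negP /u0].
by rewrite -fsbig_seq.
Qed.

Lemma finite_supp_seq (A : nmodType) (V : choiceType) (u : V -> A)
    (s : seq V) :
  (forall x, x \notin s -> u x = 0) -> finite_set [set x | u x != 0].
Proof.
move=> u0; apply: (@sub_finite_set _ _ [set` s]); last exact: finite_seq.
by move=> x /=; apply: contraNT => /u0 ->.
Qed.

Lemma esum_seq (R : realType) (V : choiceType) (u : V -> R) (s : seq V) :
  uniq s -> (forall x, 0 <= u x) -> (forall x, x \notin s -> u x = 0) ->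
  (\esum_(x in [set: V]) (u x)%:E = (\sum_(x <- s) u x)%:E)%E.
Proof.
move=> us u_ge0 u0; rewrite esum_finite_supp ?(fsum_seq us)//.
exact: finite_supp_seq u0.
Qed.

Lemma csum_seq (R : realType) (V : choiceType) (u : V -> R[i]) (s : seq V) :
  uniq s -> (forall x, x \notin s -> u x = 0) ->
  csum u = \sum_(x <- s) u x.
Proof.
move=> us u0; apply/eqP; rewrite eq_complex /= Re_sum Im_sum.
have r0 x : x \notin s -> complex.Re (u x) = 0 by move=> /u0 ->.
have i0 x : x \notin s -> complex.Im (u x) = 0 by move=> /u0 ->.
by rewrite !rsum_finite_supp ?(fsum_seq us) ?eqxx//;
  apply: finite_supp_seq; eassumption.
Qed.

(** The list consists of the support of [f] together with all in- and out-neighbours of its points,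
    a finite set by local finiteness. A single list then carries the inner products and the weights
    at every point of the support. *)
Lemma Cc_closed_support (R : realType) (V : countType) (G : wdigraph R V)
    (f : V -> R[i]) : locally_finite G -> Cc f ->
  exists s : seq V, [/\ uniq s, forall x, x \notin s -> f x = 0 &
    forall x y, f x != 0 -> y \notin s -> weight G x y = 0 /\ weight G y x = 0].
Proof.
move=> lf fC.
have /finite_seqP [s sE] : finite_set ([set x | f x != 0] `|`
    \bigcup_(x in [set x | f x != 0]) [set y | edge G x y \/ edge G y x]).
  by rewrite finite_setU; split=> //; apply: bigcup_finite.
exists (undup s); split; first exact: undup_uniq.
  move=> x; rewrite mem_undup => xs; apply/eqP; apply: contraNT xs => fx.
  have : [set` s] x by rewrite -sE; left.
  by [].
move=> x y fx; rewrite mem_undup => ys.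
have nxy : ~ (edge G x y \/ edge G y x).
  move=> xy; move/negP: ys; apply.
  by have : [set` s] y by rewrite -sE; right; exists x.
by split; apply: weight_eq0 => // -[]; tauto.
Qed.

(** Exchanging the sums on the right puts the column sum of [b] in front of [q x]. Balance is asked
    only where [q x != 0]: at other points the list [s] may miss neighbours, and the truncated row
    and column sums may differ. *)
Lemma sum_balanced (R : realType) (V : eqType) (b : V -> V -> R) (q : V -> R)
    (s : seq V) :
  (forall x, q x != 0 -> \sum_(y <- s) b x y = \sum_(y <- s) b y x) ->
  \sum_(x <- s) \sum_(y <- s) b x y * q x =
  \sum_(x <- s) \sum_(y <- s) b x y * q y.
Proof.
move=> bal; rewrite [RHS]exchange_big /=; apply: eq_bigr => x _.
rewrite -!mulr_suml; have [->|/bal ->//] := eqVneq (q x) 0.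
by rewrite !mulr0.
Qed.

(** For [f = u + i v] the summand is [b x y] times the real part of [(f x - f y) * conj (f x)]. *)
Lemma Re_form_ge0 (R : realType) (V : eqType) (b : V -> V -> R) (u v : V -> R)
    (s : seq V) : (forall x y, 0 <= b x y) ->
  (forall x, u x ^+ 2 + v x ^+ 2 != 0 ->
     \sum_(y <- s) b x y = \sum_(y <- s) b y x) ->
  0 <= \sum_(x <- s) \sum_(y <- s)
         b x y * (u x ^+ 2 + v x ^+ 2 - u y * u x - v y * v x).
Proof.
move=> b0 /sum_balanced bal; set S := (X in 0 <= X).
suff -> : S = 2^-1 * \sum_(x <- s) \sum_(y <- s)
    b x y * ((u x - u y) ^+ 2 + (v x - v y) ^+ 2).
  apply: mulr_ge0; first by rewrite invr_ge0.
  apply: sumr_ge0 => x _; apply: sumr_ge0 => y _; apply: mulr_ge0 => //.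
  by rewrite addr_ge0 ?sqr_ge0.
have {}bal : \sum_(x <- s) \sum_(y <- s) b x y *
    ((u y ^+ 2 + v y ^+ 2) - (u x ^+ 2 + v x ^+ 2)) = 0.
  under eq_bigr do (under eq_bigr do rewrite mulrBr; rewrite sumrB).
  by rewrite sumrB bal subrr.
(* Adding this vanishing term makes the claimed identity hold summand by summand. *)
have -> : S = S + 2^-1 * \sum_(x <- s) \sum_(y <- s) b x y *
    ((u y ^+ 2 + v y ^+ 2) - (u x ^+ 2 + v x ^+ 2)).
  by rewrite bal mulr0 addr0.
rewrite /S !mulr_sumr -big_split /=.
apply: eq_bigr => x _; rewrite !mulr_sumr -big_split /=.
by apply: eq_bigr => y _; field.
Qed.

(** The factor [u y * v x - v y * u x] is the imaginary part of [(f x - f y) * conj (f x)] for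
    [f = u + i v]. *)
Lemma Im_form_le (R : realType) (V : eqType) (b : V -> V -> R) (u v m : V -> R)
    (M : R) (s : seq V) :
  (forall x, u x ^+ 2 + v x ^+ 2 != 0 ->
     \sum_(y <- s) `|b x y - b y x| <= M * m x) ->
  `|\sum_(x <- s) \sum_(y <- s) b x y * (u y * v x - v y * u x)| <=
  M / 2 * \sum_(x <- s) m x * (u x ^+ 2 + v x ^+ 2).
Proof.
move=> gam; set S := \sum_(x <- s) _; set q := fun x => u x ^+ 2 + v x ^+ 2.
have q0 x : 0 <= q x by rewrite addr_ge0 ?sqr_ge0.
pose c x y := `|b x y - b y x|.
(* [S] is averaged with its copy in which [x] and [y] are exchanged; the second factor changes sign
   under the exchange. *)
have SE : S = 2^-1 * \sum_(x <- s) \sum_(y <- s)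
    (b x y - b y x) * (u y * v x - v y * u x).
  have SN : S = \sum_(x <- s) \sum_(y <- s)
      - (b y x * (u y * v x - v y * u x)).
    rewrite /S exchange_big /=; apply: eq_bigr => x _; apply: eq_bigr => y _.
    by ring.
  apply: (@mulfI _ 2) => //; rewrite mulrA divff// mul1r.
  rewrite mulr_natl mulr2n {1}/S SN -big_split; apply: eq_bigr => x _ /=.
  by rewrite -big_split; apply: eq_bigr => y _ /=; ring.
(* [c] is symmetric, so its row and column sums agree at every point. *)
have cq : \sum_(x <- s) \sum_(y <- s) c x y * q x =
          \sum_(x <- s) \sum_(y <- s) c x y * q y.
  by apply: sum_balanced => x _; apply: eq_bigr => y _; rewrite /c distrC.
rewrite SE normrM ger0_norm ?invr_ge0// -mulrA mulrCA ler_pM2l ?invr_gt0//.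
apply: (@le_trans _ _ (\sum_(x <- s) \sum_(y <- s) c x y * q x)).
  apply: (@le_trans _ _ (\sum_(x <- s) \sum_(y <- s)
      c x y * (2^-1 * (q x + q y)))); last first.
    rewrite le_eqVlt; apply/orP; left; apply/eqP.
    have -> : \sum_(x <- s) \sum_(y <- s) c x y * (2^-1 * (q x + q y)) =
        2^-1 * (\sum_(x <- s) \sum_(y <- s) c x y * q x +
                \sum_(x <- s) \sum_(y <- s) c x y * q y).
      rewrite -big_split mulr_sumr; apply: eq_bigr => x _ /=.
      by rewrite -big_split mulr_sumr; apply: eq_bigr => y _ /=; ring.
    by rewrite -cq; field.
  apply: le_trans (ler_norm_sum _ _ _) _; apply: ler_sum => x _.
  apply: le_trans (ler_norm_sum _ _ _) _; apply: ler_sum => y _.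
  (* Each bound expands a sum of two squares whose square terms add up to [q x + q y]. *)
  rewrite normrM ler_wpM2l// /q /= ler_norml; apply/andP; split.
    have h1 := sqr_ge0 (u y + v x); have h2 := sqr_ge0 (v y - u x).
    by lra.
  have h1 := sqr_ge0 (u y - v x); have h2 := sqr_ge0 (v y + u x).
  by lra.
rewrite mulr_sumr; apply: ler_sum => x _; rewrite -mulr_suml mulrA -/(q x).
have [->|qx] := eqVneq (q x) 0; first by rewrite !mulr0.
by rewrite ler_wpM2r// gam.
Qed.

(** For [z != 0], the cosine [c] of the argument is nonnegative with [c ^+ 2 >= 1/2], the square of
    [cos (pi / 4)], and cosine decreases on [[0, pi]]. For [z = 0] the convention [arg 0 = 0]
    applies. *)
Lemma arg_le_pi4 (R : realType) (z : R[i]) :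
  `|complex.Im z| <= complex.Re z -> `|arg z| <= pi / 4.
Proof.
case: z => x y /= yx; rewrite /arg; case: eqVneq => [_|z0].
  by rewrite normr0 divr_ge0 ?pi_ge0.
have pi_gt0 := pi_gt0 R.
set c := _ / _; have x0 : 0 <= x := le_trans (normr_ge0 _) yx.
have yx2 : y ^+ 2 <= x ^+ 2.
  by rewrite -[y ^+ 2]real_normK ?num_real// ler_pXn2r ?nnegrE.
have n_gt0 : 0 < normc (x +i* y).
  rewrite lt_def sqrtr_ge0 andbT.
  by apply: contra z0 => /eqP/eq0_normc ->.
have n2 : normc (x +i* y) ^+ 2 = x ^+ 2 + y ^+ 2.
  by rewrite sqr_sqrtr// addr_ge0// sqr_ge0.
have c0 : 0 <= c by rewrite divr_ge0// ltW.
have cE : c ^+ 2 = x ^+ 2 / (x ^+ 2 + y ^+ 2) by rewrite expr_div_n n2.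
have d_gt0 : 0 < x ^+ 2 + y ^+ 2 by rewrite -n2 exprn_gt0.
have c1 : c <= 1.
  rewrite -(@ler_pXn2r _ 2) ?nnegrE// cE expr1n ler_pdivrMr// mul1r.
  by rewrite lerDl sqr_ge0.
have c2 : 2^-1 <= c ^+ 2 by rewrite cE ler_pdivlMr//; lra.
have cI : -1 <= c <= 1 by rewrite c1 andbT (le_trans _ c0)// lerN10.
have a0 : 0 <= acos c by rewrite acos_ge0.
suff : acos c <= pi / 4.
  by move=> aI; case: ifP => _; rewrite ?normrN ger0_norm.
(* Double angle formula at [pi / 4]. *)
have cos4 : cos (pi / 4 : R) ^+ 2 = 2^-1.
  have : cos (pi / 2 : R) = 0 by rewrite cos_pihalf.
  have -> : pi / 2 = (pi / 4) *+ 2 :> R by rewrite mulr2n; field.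
  by rewrite cos_mulr2n => h; lra.
have cos4_ge0 : 0 <= cos (pi / 4 : R).
  by apply: cos_ge0_pihalf; apply/andP; split; lra.
rewrite leNgt; apply/negP => lt4.
have : cos (acos c) < cos (pi / 4).
  rewrite ltr_cos// !in_itv /= ?a0 ?acos_lepi//.
  by apply/andP; split; lra.
rewrite acosK ?in_itv// -(@ltr_pXn2r _ 2) ?nnegrE// cos4.
by rewrite ltNge c2.
Qed.

(** Translating by [K] gives [|Im z| <= K <= Re z + K]. *)
Lemma strip_sub_sector (R : realType) (K : R) :
  [set z : R[i] | 0 <= complex.Re z /\ `|complex.Im z| <= K] `<=`
  sector (- K) (pi / 4).
Proof.
move=> [x y] [/= x0 yK]; apply: arg_le_pi4 => /=.
by rewrite oppr0 addr0; lra.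
Qed.

Theorem proposition2p2 (R : realType) (V : countType) (G : wdigraph R V)
    (m : V -> R) (m_gt0 : forall x, 0 < m x)
    (G_connected : digraph_connected G) (G_lf : locally_finite G)
    (G_out : forall x, exists y, edge G x y)
    (G_beta : assumption_beta G) (G_gamma : assumption_gamma G m) :
  sectorial (laplacian_op m G_lf).
Proof.
case: G_gamma => M M_gt0 gamma; exists (- (M / 2)), (pi / 4).
have pi_gt0 := pi_gt0 R; split; first by apply/andP; split; lra.
move=> _ [f fC [f1 ->]]; apply: strip_sub_sector.
have [s [us fs bs]] := Cc_closed_support G_lf fC.
pose u x := complex.Re (f x); pose v x := complex.Im (f x).
have uvE x : (u x ^+ 2 + v x ^+ 2 != 0) = (f x != 0).
  by rewrite paddr_eq0 ?sqr_ge0// !sqrf_eq0 eq_complex.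
(* At a point of the support all neighbours lie in [s], so the infinite sums of (beta) are exactly
   sums over [s]; likewise for (gamma) below. *)
have bal x : u x ^+ 2 + v x ^+ 2 != 0 ->
    \sum_(y <- s) weight G x y = \sum_(y <- s) weight G y x.
  rewrite uvE => fx; have := G_beta x.
  have w0 y : y \notin s -> weight G x y = 0 by move=> /(bs x y fx) [].
  have w0' y : y \notin s -> weight G y x = 0 by move=> /(bs x y fx) [].
  by rewrite !(esum_seq us) => // [[]|y|y]; rewrite ?weight_ge0.
have gam x : u x ^+ 2 + v x ^+ 2 != 0 ->
    \sum_(y <- s) `|weight G x y - weight G y x| <= M * m x.
  rewrite uvE => fx; have := gamma x.
  rewrite (esum_seq us) ?lee_fin// => y /(bs x y fx) [-> ->].
  by rewrite subrr normr0.
have nf : \sum_(x <- s) m x * (u x ^+ 2 + v x ^+ 2) = 1.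
  have : l2norm m f ^+ 2 = 1 by rewrite f1 expr1n.
  rewrite /l2norm /l2dot (csum_seq us); last first.
    by move=> x /fs ->; rewrite mulr0 mul0r.
  have -> : complex.Re (\sum_(x <- s) (m x)%:C * f x * (f x)^*%C) =
      \sum_(x <- s) m x * (u x ^+ 2 + v x ^+ 2).
    rewrite Re_sum; apply: eq_bigr => x _; rewrite /u /v.
    by case: (f x) => a b /=; ring.
  rewrite sqr_sqrtr//; apply: sumr_ge0 => x _.
  by rewrite mulr_ge0 ?(ltW (m_gt0 x))// addr_ge0 ?sqr_ge0.
have zE : l2dot m (laplacian G m f) f = \sum_(x <- s) \sum_(y <- s)
    (weight G x y)%:C * (f x - f y) * (f x)^*%C.
  rewrite /l2dot (csum_seq us); last by move=> x /fs ->; rewrite conjc0 mulr0.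
  (* Off the support the factor [conj (f x)] kills both sides. On it, the measure cancels against
     the [(m x)^-1] of the Laplacian, and the sum over [V] reduces to [s]. *)
  apply: eq_bigr => x _; have [->|fx] := eqVneq (f x) 0.
    by rewrite conjc0 mulr0 big1// => y _; rewrite mulr0.
  rewrite /laplacian mulrA -rmorphM /= divff ?gt_eqF// mul1r -mulr_suml.
  by rewrite (fsum_seq us)// => y /(bs x y fx) [-> _]; rewrite mul0r.
rewrite -[op _ _]/(laplacian G m f) zE; split.
  rewrite Re_sum; under eq_bigr do rewrite Re_sum.
  have := Re_form_ge0 (@weight_ge0 _ _ G) bal.
  congr (0 <= _); apply: eq_bigr => x _; apply: eq_bigr => y _; rewrite /u /v.
  by case: (f x) (f y) => a b [c d] /=; ring.
rewrite Im_sum; under eq_bigr do rewrite Im_sum.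
(* The normalisation of [f] turns the bound into the constant [M / 2]. *)
have := Im_form_le gam; rewrite nf mulr1; congr (`|_| <= _).
apply: eq_bigr => x _; apply: eq_bigr => y _; rewrite /u /v.
by case: (f x) (f y) => a b [c d] /=; ring.
Qed.
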